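(* Let $m_0\ge1$, $p=2+m_0$, let $X\in\mathbb{R}^{n\times p}$ be a fair design with $X_1^TX_2=-\hat\rho$, $0<\hat\rho<1$, $\hat\varphi^2:=1-\hat\rho$, and let $\beta^0\in\mathbb{R}^p$ have active set $S_0=\{1,2\}$. Let $X_{-S_0}:=\{X_j\}_{j\notin S_0}\in\mathbb{R}^{n\times m_0}$ satisfy $X_{-S_0}^TX_{-S_0}=I$, and suppose $$X_1=CX_{-S_0}\gamma_{-S_0}+V,\qquad X_2=CX_{-S_0}\gamma_{-S_0}-V,$$ where $V^TX_{-S_0}=0$, $\gamma_{-S_0}\in\mathbb{R}^{m_0}$ and $C$ is a constant. Assume moreover $\|\gamma_{-S_0}\|_1=1$, $2C^2\|\gamma_{-S_0}\|_2^2<1$ and $\|\gamma_{-S_0}\|_\infty\le C\|\gamma_{-S_0}\|_2^2$. Then $$\hat\phi^2(S_0)=2\min_{\|\beta_{-S_0}\|_1\le1}\|C\gamma_{-S_0}-\beta_{-S_0}\|_2^2,\qquad\hat\varphi^2=2C^2\|\gamma_{-S_0}\|_2^2,$$ where the minimum is over $\beta_{-S_0}\in\mathbb{R}^{m_0}$, and moreover for $\lambda>0$ and $\beta_1^0\ge\beta_2^0\ge\lambda/\hat\varphi^2$, the noiseless Lasso $\beta^*$ satisfies $$\|X(\beta^*-\beta^0)\|_2^2=\frac{2\lambda^2}{\hat\varphi^2}.$$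
   Context: Fair design: all columns satisfy $\|X_j\|_2=1$ and there are no $j\ne k$ and constant $b$ with $X_j=bX_k$. The noiseless Lasso is $\beta^*:=\arg\min_{\beta\in\mathbb{R}^p}\{\|X(\beta-\beta^0)\|_2^2+2\lambda\|\beta\|_1\}$. For $S\subset\{1,\ldots,p\}$, $\beta_S$ is the vector with entries $\beta_j$ for $j\in S$ and $0$ otherwise (or the corresponding $|S|$-dimensional vector), and $\beta_{-S}:=\beta_{S^c}$. The compatibility constant is $\hat\phi^2(S):=\min\{|S|\,\|X\beta\|_2^2:\ \|\beta_S\|_1=1,\ \|\beta_{-S}\|_1\le1\}$. *)

(* Defs.v *)
From mathcomp Require Import all_boot all_order all_algebra.
From mathcomp Require Import classical_sets reals normedtype.

Set Implicit Arguments.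
Unset Strict Implicit.
Unset Printing Implicit Defensive.

Import Order.TTheory GRing.Theory Num.Theory.
Import numFieldNormedType.Exports.

Local Open Scope classical_set_scope.
Local Open Scope ring_scope.

(* The sup norm of a column vector is the library's norm `|v| on matrices
   (see mx_normrE). *)
Definition l1norm (R : realType) (n : nat) (v : 'cV[R]_n) : R :=
  \sum_(i < n) `|v i 0|.

Definition l2norm (R : realType) (n : nat) (v : 'cV[R]_n) : R :=
  Num.sqrt (\sum_(i < n) v i 0 ^+ 2).

Definition is_minimum (R : realType) (A : set R) (m : R) : Prop :=
  A m /\ lbound A m.

Definition fair_design (R : realType) (n p : nat) (X : 'M[R]_(n, p)) : Prop :=
  (forall j, l2norm (col j X) = 1) /\
  ~ (exists j k, j != k /\ exists b : R, col j X = b *: col k X).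

Definition active_set (R : realType) (p : nat) (b : 'cV[R]_p) : {set 'I_p} :=
  [set j | b j 0 != 0]%SET.

Definition restr (R : realType) (p : nat) (S : {set 'I_p}) (b : 'cV[R]_p) :
    'cV[R]_p :=
  \col_j (if j \in S then b j 0 else 0).

Definition lasso_objective (R : realType) (n p : nat) (X : 'M[R]_(n, p))
    (beta0 : 'cV[R]_p) (lambda : R) (b : 'cV[R]_p) : R :=
  l2norm (X *m (b - beta0)) ^+ 2 + 2 * lambda * l1norm b.

(* The argmin is a set: minimizers need not be unique. *)
Definition noiseless_lasso (R : realType) (n p : nat) (X : 'M[R]_(n, p))
    (beta0 : 'cV[R]_p) (lambda : R) : set 'cV[R]_p :=
  [set b | forall b' : 'cV[R]_p,
     lasso_objective X beta0 lambda b <= lasso_objective X beta0 lambda b'].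

(* phi2 is the value of the squared compatibility constant of S; the minimum
   is required to be attained, hence phi2 is unique when it exists. *)
Definition is_compat_sq (R : realType) (n p : nat) (X : 'M[R]_(n, p))
    (S : {set 'I_p}) (phi2 : R) : Prop :=
  is_minimum
    [set #|S|%:R * l2norm (X *m b) ^+ 2 | b in
       [set b : 'cV[R]_p | l1norm (restr S b) = 1 /\
                           l1norm (restr (~: S)%SET b) <= 1]]
    phi2.

(* The two indices written 1 and 2 on paper; the remaining m0 indices are the
   rshift 2 k, so that X_{-S0} is rsubmx X. *)
Definition idx1 (m0 : nat) : 'I_(2 + m0) := lshift m0 (ord0 : 'I_2).
Definition idx2 (m0 : nat) : 'I_(2 + m0) := lshift m0 (ord_max : 'I_2).

Definition S0 (m0 : nat) : {set 'I_(2 + m0)} := [set idx1 m0; idx2 m0]%SET.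

(* Main.v *)
(* Write Z for the block X_{-S0} and b = (x, y, c). Since Z is orthonormal and
   V is orthogonal to it,
     |X b|_2^2 = |C (x + y) gamma + c|_2^2 + (x - y)^2 |V|_2^2,
   and the two unit-norm columns give 2 C^2 |gamma|_2^2 = 1 - rho and
   |V|_2^2 = (1 + rho) / 2.
   Compatibility: |x| + |y| = 1 forces |x + y| = 1 or |x - y| = 1. The first
   case is an approximation of C gamma in the l1 ball up to sign; the second
   costs at least |V|_2^2 > 1/2 > |C gamma|_2^2, more than the candidate c = 0.
   Lasso: subtracting lambda / phi2 from both active coefficients of beta0 gives
   a KKT point with dual certificate (1, 1, 2 C gamma / phi2), whose last block
   is bounded by 1 thanks to the sup norm condition; all minimizers have the
   same prediction. *)

Require Import Defs.
From mathcomp Require Import all_boot all_order all_algebra.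
From mathcomp Require Import classical_sets reals normedtype.
From mathcomp Require Import boolp topology derive ring lra.
Set Implicit Arguments.
Unset Strict Implicit.
Unset Printing Implicit Defensive.

Import Order.TTheory GRing.Theory Num.Theory.
Import numFieldNormedType.Exports.
Local Open Scope classical_set_scope.
Local Open Scope ring_scope.

(** * Euclidean inner product and norms of column vectors *)

Definition dot (R : realType) (n : nat) (u v : 'cV[R]_n) : R := (u^T *m v) 0 0.

Lemma dotE (R : realType) (n : nat) (u v : 'cV[R]_n) :
  dot u v = \sum_i u i 0 * v i 0.
Proof. by rewrite /dot mxE; apply: eq_bigr => i _; rewrite mxE. Qed.

Lemma dotC (R : realType) (n : nat) (u v : 'cV[R]_n) : dot u v = dot v u.
Proof. by rewrite !dotE; apply: eq_bigr => i _; rewrite mulrC. Qed.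

Lemma dotDr (R : realType) (n : nat) (u v w : 'cV[R]_n) :
  dot u (v + w) = dot u v + dot u w.
Proof. by rewrite /dot mulmxDr mxE. Qed.

Lemma dotZr (R : realType) (n : nat) (a : R) (u v : 'cV[R]_n) :
  dot u (a *: v) = a * dot u v.
Proof. by rewrite /dot -scalemxAr mxE. Qed.

Lemma dotDl (R : realType) (n : nat) (u v w : 'cV[R]_n) :
  dot (u + v) w = dot u w + dot v w.
Proof. by rewrite dotC dotDr !(dotC w). Qed.

Lemma dotZl (R : realType) (n : nat) (a : R) (u v : 'cV[R]_n) :
  dot (a *: u) v = a * dot u v.
Proof. by rewrite dotC dotZr dotC. Qed.

Lemma dot_mulmxl (R : realType) (n p : nat) (A : 'M[R]_(n, p)) u v :
  dot (A *m u) v = dot u (A^T *m v).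
Proof. by rewrite /dot trmx_mul mulmxA. Qed.

Lemma l2norm_sqr (R : realType) (n : nat) (u : 'cV[R]_n) :
  l2norm u ^+ 2 = dot u u.
Proof. by rewrite dotE sqr_sqrtr // sumr_ge0 // => i _; rewrite sqr_ge0. Qed.

Lemma dotvv_ge0 (R : realType) (n : nat) (u : 'cV[R]_n) : 0 <= dot u u.
Proof. by rewrite -l2norm_sqr sqr_ge0. Qed.

Lemma dotvv_eq0 (R : realType) (n : nat) (u : 'cV[R]_n) : dot u u = 0 -> u = 0.
Proof.
rewrite dotE => /psumr_eq0P h; apply/matrixP => i j; rewrite ord1 mxE.
by apply/eqP; rewrite -sqrf_eq0 expr2 h // => k _; rewrite -expr2 sqr_ge0.
Qed.

Lemma entry_le_l1norm (R : realType) (n : nat) (v : 'cV[R]_n) i :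
  `|v i 0| <= l1norm v.
Proof. by rewrite /l1norm (bigD1 i) //= lerDl sumr_ge0. Qed.

Lemma entry_le_norm (R : realType) (n : nat) (v : 'cV[R]_n) i :
  `|v i 0| <= `|v|.
Proof.
rewrite [leRHS]/Num.norm /= mx_normrE.
exact: (le_bigmax _ (fun ij => `|v ij.1 ij.2|) (i, 0)).
Qed.

(** The l1 ball is compact: each entry is bounded by the l1 norm, and the ball is closed as a
    preimage under a continuous map. It contains 0 because [0 <= r], so the continuous squared
    distance attains its minimum. The argument runs on row vectors, the form that
    [bounded_closed_compact] and [EVT_min_rV] take. *)
Lemma l1norm_ball_l2_min (R : realType) (m : nat) (r : R) (u : 'cV[R]_m) :
  0 <= r ->
  exists2 b, l1norm b <= r &
    forall b', l1norm b' <= r -> l2norm (u - b) ^+ 2 <= l2norm (u - b') ^+ 2.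
Proof.
move=> r0.
pose A := [set v : 'rV[R]_m | l1norm v^T <= r].
have ccst (i : 'I_m) : continuous (fun v : 'rV[R]_m => v^T i 0).
  move=> v; rewrite (_ : (fun _ => _) = (fun v : 'rV[R]_m => v 0 i)).
    exact: coord_continuous.
  by apply/funext => w; rewrite mxE.
have cl1 : continuous (fun v : 'rV[R]_m => l1norm v^T).
  apply: continuous_big => [|i _ v]; first exact: add_continuous.
  exact: (continuous_comp (ccst i v) (@norm_continuous _ R^o _)).
have cA : compact A.
  apply: bounded_closed_compact.
    exists r; split=> [|M rM v]; first exact: num_real.
    rewrite /A /= => Av; rewrite [leLHS]/Num.norm /= mx_normrE.
    apply/bigmax_leP; split=> [|[i j] _ /=]; first exact: ltW (le_lt_trans r0 rM).
    rewrite ord1; have := entry_le_l1norm v^T j; rewrite mxE => /le_trans; apply.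
    exact: le_trans Av (ltW rM).
  apply: (@preimage_closed _ _ (fun v : 'rV[R]_m => l1norm v^T) [set x | x <= r]).
    by move=> v _; exact: cl1.
  exact: closed_le.
have cf : continuous (fun v : 'rV[R]_m => l2norm (u - v^T) ^+ 2).
  rewrite (_ : (fun _ => _) =
    (fun v : 'rV[R]_m => \sum_i (u i 0 - v^T i 0) * (u i 0 - v^T i 0))).
    apply: continuous_big => [|i _ v]; first exact: add_continuous.
    have cB : {for v, continuous (fun v : 'rV[R]_m => u i 0 - v^T i 0)}.
      exact: (continuousB (@cst_continuous _ _ (u i 0) v) (ccst i v)).
    exact: (continuousM cB cB).
  by apply/funext => v; rewrite l2norm_sqr dotE; apply: eq_bigr => i _; rewrite !mxE.
have A0 : A !=set0.
  by exists 0; rewrite /A /= /l1norm big1 // => i _; rewrite !mxE normr0.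
have [c] := EVT_min_rV A0 cA (continuous_subspaceT cf).
rewrite inE => Ac cmin; exists c^T => // b' b'r.
have := cmin b'^T; rewrite !trmxK; apply; by rewrite inE /A /= trmxK.
Qed.

(* The subgradient [z] certifies [b]: the objective at any [b'] exceeds the one
   at [b] by at least |X (b' - b)|_2^2. *)
Lemma noiseless_lasso_prediction_unique (R : realType) (n p : nat)
    (X : 'M[R]_(n, p)) (beta0 : 'cV[R]_p) (lambda : R) (b z b' : 'cV[R]_p) :
  0 < lambda ->
  X^T *m (X *m (b - beta0)) = - lambda *: z ->
  (forall j, `|z j 0| <= 1) -> (forall j, z j 0 * b j 0 = `|b j 0|) ->
  noiseless_lasso X beta0 lambda b' -> X *m b' = X *m b.
Proof.
move=> l0 kkt z1 zb /(_ b); rewrite /lasso_objective.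
(* Expand the square around the residual of [b]; stationarity turns the cross term into a multiple
   of [dot (b' - b) z]. *)
have -> : X *m (b' - beta0) = X *m (b' - b) + X *m (b - beta0).
  by rewrite -mulmxDr subrKA.
rewrite !l2norm_sqr !(dotDl, dotDr) (dotC (X *m (b - beta0))).
rewrite [dot _ (X *m (b - _))]dot_mulmxl kkt dotZr.
have -> : dot (b' - b) z = dot z b' - l1norm b.
  rewrite dotC dotDr; congr (_ + _).
  rewrite -scaleN1r dotZr mulN1r dotE; congr (- _).
  by apply: eq_bigr => i _; rewrite zb.
have zb' : dot z b' <= l1norm b'.
  rewrite dotE; apply: ler_sum => i _; apply: le_trans (ler_norm _) _.
  by rewrite normrM ler_piMl.
have := dotvv_ge0 (X *m (b' - b)) => d0 h.
have lz : lambda * dot z b' <= lambda * l1norm b' by rewrite ler_pM2l.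
apply/eqP; rewrite -subr_eq0 -mulmxBr; apply/eqP/dotvv_eq0; lra.
Qed.

(** * Splitting into the two active indices and the rest *)

Lemma mulmx_two_blocks (R : realType) (n m0 : nat) (X : 'M[R]_(n, 2 + m0)) b :
  X *m b = b (idx1 m0) 0 *: col (idx1 m0) X + b (idx2 m0) 0 *: col (idx2 m0) X
           + rsubmx X *m dsubmx b.
Proof.
apply/matrixP => i j; rewrite ord1 !mxE big_split_ord /= !big_ord_recl big_ord0.
rewrite addr0 ![X _ _ * b _ _]mulrC; congr (_ * _ + _ * _ + _).
- by congr (b _ _); apply/val_inj.
- by congr (X _ _); apply/val_inj.
by apply: eq_bigr => k _; rewrite !mxE.
Qed.

Lemma l1norm_restr_S0 (R : realType) (m0 : nat) (b : 'cV[R]_(2 + m0)) :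
  l1norm (restr (S0 m0) b) = `|b (idx1 m0) 0| + `|b (idx2 m0) 0|.
Proof.
rewrite /l1norm big_split_ord /= !big_ord_recl big_ord0 addr0.
rewrite [X in _ + X]big1 ?addr0 => [|k _]; last by rewrite mxE !inE normr0.
rewrite !mxE !inE /=.
by congr (`|b _ _| + `|b _ _|); apply/val_inj.
Qed.

Lemma l1norm_restr_S0C (R : realType) (m0 : nat) (b : 'cV[R]_(2 + m0)) :
  l1norm (restr (~: S0 m0)%SET b) = l1norm (dsubmx b).
Proof.
rewrite /l1norm big_split_ord /= [X in X + _]big1 ?add0r => [|k _].
  by apply: eq_bigr => k _; rewrite !mxE !inE.
rewrite mxE !inE; case: k => [[|[|k]] hk] //; by rewrite normr0.
Qed.

(** [Z] is an isometry and [V] is orthogonal to its range, so all cross terms vanish. *)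
Lemma dot_orthonormal_decomposition (R : realType) (n m : nat)
    (Z : 'M[R]_(n, m)) (V : 'cV[R]_n) (w w' : 'cV[R]_m) (d d' : R) :
  Z^T *m Z = 1%:M -> V^T *m Z = 0 ->
  dot (Z *m w + d *: V) (Z *m w' + d' *: V) = dot w w' + d * d' * dot V V.
Proof.
move=> ZZ VZ.
have V0 x : dot V (Z *m x) = 0 by rewrite /dot mulmxA VZ mul0mx mxE.
rewrite !(dotDl, dotDr, dotZl, dotZr) V0 (dotC _ V) V0 dot_mulmxl mulmxA ZZ mul1mx.
by rewrite !mulr0 addr0 add0r mulrA.
Qed.

Unset Implicit Arguments.

Theorem lemma14p3 (R : realType) (n m0 : nat) (hm0 : (1 <= m0)%N)
    (X : 'M[R]_(n, 2 + m0)) (hX : fair_design X)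
    (rho phi2 : R)
    (hrho : (col (idx1 m0) X)^T *m col (idx2 m0) X = (- rho)%:M)
    (hrho0 : 0 < rho) (hrho1 : rho < 1)
    (hphi2 : phi2 = 1 - rho)
    (beta0 : 'cV[R]_(2 + m0)) (hbeta0 : active_set beta0 = S0 m0)
    (horth : (rsubmx X)^T *m rsubmx X = 1%:M)
    (C : R) (gamma : 'cV[R]_m0) (V : 'cV[R]_n)
    (hX1 : col (idx1 m0) X = C *: (rsubmx X *m gamma) + V)
    (hX2 : col (idx2 m0) X = C *: (rsubmx X *m gamma) - V)
    (hV : V^T *m rsubmx X = 0)
    (hgamma1 : l1norm gamma = 1)
    (hgamma2 : 2 * C ^+ 2 * l2norm gamma ^+ 2 < 1)
    (hgammaoo : `|gamma| <= C * l2norm gamma ^+ 2) :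
  (exists m : R,
     is_minimum [set l2norm (C *: gamma - b) ^+ 2 | b in
                   [set b : 'cV[R]_m0 | l1norm b <= 1]] m /\
     is_compat_sq X (S0 m0) (2 * m)) /\
  phi2 = 2 * C ^+ 2 * l2norm gamma ^+ 2 /\
  (forall lambda : R, 0 < lambda ->
     beta0 (idx2 m0) 0 <= beta0 (idx1 m0) 0 ->
     lambda / phi2 <= beta0 (idx2 m0) 0 ->
     forall betas : 'cV[R]_(2 + m0),
       noiseless_lasso X beta0 lambda betas ->
       l2norm (X *m (betas - beta0)) ^+ 2 = 2 * lambda ^+ 2 / phi2).
Proof.

(* Coordinates of predictions and Gram identities of the active columns *)
have Xdec (b : 'cV[R]_(2 + m0)) : X *m b =
    rsubmx X *m ((C * (b (idx1 m0) 0 + b (idx2 m0) 0)) *: gamma + dsubmx b)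
    + (b (idx1 m0) 0 - b (idx2 m0) 0) *: V.
  rewrite mulmx_two_blocks hX1 hX2 mulmxDr -scalemxAr.
  by apply/matrixP => i j; rewrite !mxE; ring.
have dec := dot_orthonormal_decomposition _ _ _ _ horth hV.
have eX1 : col (idx1 m0) X = rsubmx X *m (C *: gamma) + 1 *: V.
  by rewrite hX1 scale1r scalemxAr.
have eX2 : col (idx2 m0) X = rsubmx X *m (C *: gamma) + (-1) *: V.
  by rewrite hX2 scaleN1r scalemxAr.
have d11 : C ^+ 2 * dot gamma gamma + dot V V = 1.
  have := l2norm_sqr (col (idx1 m0) X).
  rewrite (proj1 hX) eX1 dec !(dotZl, dotZr) expr1n => ->; ring.
have d12 : C ^+ 2 * dot gamma gamma - dot V V = - rho.
  transitivity (dot (col (idx1 m0) X) (col (idx2 m0) X)).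
    rewrite eX1 eX2 dec !(dotZl, dotZr); ring.
  by rewrite /dot hrho mxE.
have phi2E : phi2 = 2 * C ^+ 2 * l2norm gamma ^+ 2 by rewrite l2norm_sqr; lra.
have phi2_gt0 : 0 < phi2 by lra.
split; last split=> //.

  (* The compatibility constant *)
  have [c c1 cmin] := @l1norm_ball_l2_min R m0 1 (C *: gamma) ler01.
  exists (l2norm (C *: gamma - c) ^+ 2); split; first split.
  - by exists c.
  - by move=> _ [b b1 <-]; apply: cmin.
  have Xsqr (b : 'cV[R]_(2 + m0)) : #|S0 m0|%:R * l2norm (X *m b) ^+ 2 = 2 *
     (l2norm ((C * (b (idx1 m0) 0 + b (idx2 m0) 0)) *: gamma + dsubmx b) ^+ 2
       + (b (idx1 m0) 0 - b (idx2 m0) 0) ^+ 2 * dot V V).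
    rewrite !l2norm_sqr Xdec dec expr2; congr (_%:R * _).
    by rewrite cards2.
  split.
    (* Equal weights 1/2 cancel the [V] component and give [C *: gamma] coefficient 1; the sign of
       [c] turns the sum into the difference. *)
    pose b : 'cV[R]_(2 + m0) := col_mx (const_mx 2^-1) (- c).
    have b1E : b (idx1 m0) 0 = 2^-1 by rewrite /b col_mxEu mxE.
    have b2E : b (idx2 m0) 0 = 2^-1 by rewrite /b col_mxEu mxE.
    have bdE : dsubmx b = - c by rewrite /b col_mxKd.
    exists b; last first.
      rewrite Xsqr b1E b2E bdE subrr expr0n mul0r addr0.
      by rewrite (_ : 2^-1 + 2^-1 = 1) ?mulr1 //; field.
    split; rewrite ?l1norm_restr_S0 ?l1norm_restr_S0C ?b1E ?b2E ?bdE.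
      by rewrite ger0_norm ?invr_ge0 //; field.
    rewrite (le_trans _ c1) // /l1norm le_eqVlt; apply/orP; left; apply/eqP.
    by apply: eq_bigr => i _; rewrite mxE normrN.
  move=> _ [b [b1 b2] <-]; rewrite Xsqr ler_pM2l ?ltr0n //.
  move: b1 b2; rewrite l1norm_restr_S0 l1norm_restr_S0C.
  set x := b (idx1 m0) 0; set y := b (idx2 m0) 0; set d := dsubmx b => xy1 d1.
  have sqr_norm (w : 'cV[R]_m0) : 0 <= l2norm w ^+ 2 by exact: sqr_ge0.
  have V0 := dotvv_ge0 V.
  have l1N (w : 'cV[R]_m0) : l1norm (- w) = l1norm w.
    by apply: eq_bigr => i _; rewrite mxE normrN.
  have l2N (w : 'cV[R]_m0) : l2norm (- w) ^+ 2 = l2norm w ^+ 2.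
    by rewrite !l2norm_sqr -scaleN1r dotZl dotZr; ring.
  (* Opposite signs of [x] and [y] give the first case, equal signs one of the other two. *)
  have [xy|[xy|xy]] : (x - y) ^+ 2 = 1 \/ x + y = 1 \/ x + y = - 1.
  - move: xy1; case: (ger0P x) => hx; case: (ger0P y) => hy h.
    + by right; left.
    + by left; rewrite h expr1n.
    + by left; rewrite -[x - y]opprK opprB addrC h sqrrN expr1n.
    + by right; right; lra.
  (* By [d12] and [rho > 0], the [V] term alone exceeds the squared norm of [C *: gamma], which is
     the distance at the feasible point 0. *)
  - rewrite xy mul1r.
    have := cmin 0; rewrite subr0 [l2norm (C *: gamma) ^+ 2]l2norm_sqr dotZl dotZr /l1norm.
    rewrite big1 => [/(_ ler01) h|i _]; last by rewrite mxE normr0.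
    have := sqr_norm ((C * (x + y)) *: gamma + d); lra.
  - rewrite xy mulr1; apply: le_trans (_ : _ <= l2norm (C *: gamma - - d) ^+ 2) _.
      by apply: cmin; rewrite l1N.
    by rewrite opprK lerDl mulr_ge0 // sqr_ge0.
  - rewrite xy mulrN1 scaleNr; apply: le_trans (cmin d d1) _.
    by rewrite -l2N opprB addrC lerDl mulr_ge0 // sqr_ge0.

(* The Lasso prediction error *)
move=> lambda l0 b21 lb2 betas hbetas.
(* Lowering both active coefficients by [t] gives the residual inner product [- t * phi2] with each
   active column, which must equal [- lambda]. The last block of [z] is then the correlation of the
   remaining columns with the residual, divided by [- lambda]. *)
pose t := lambda / phi2.
pose e : 'cV[R]_(2 + m0) := col_mx (const_mx t) 0.
pose z : 'cV[R]_(2 + m0) := col_mx (const_mx 1) ((2 * C / phi2) *: gamma).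
have Xe : X *m (beta0 - e - beta0) = rsubmx X *m ((- (2 * t * C)) *: gamma).
  rewrite addrAC subrr sub0r mulmxN Xdec /e col_mxKd !col_mxEu !mxE subrr scale0r.
  by rewrite !addr0 -mulmxN -scaleNr; congr (_ *m (_ *: _)); ring.
have tphi : t * phi2 = lambda by rewrite /t mulfVK ?gt_eqF.
have Cg : 2 * C ^+ 2 * dot gamma gamma = phi2 by rewrite -l2norm_sqr.
have kkt : X^T *m (X *m (beta0 - e - beta0)) = - lambda *: z.
  apply/matrixP => i j; rewrite {j}ord1.
  have -> : (X^T *m (X *m (beta0 - e - beta0))) i 0 =
            dot (col i X) (X *m (beta0 - e - beta0)).
    by rewrite mxE dotE; apply: eq_bigr => k _; rewrite !mxE.
  (* The residual has no [V] component, so [d] drops out. *)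
  have ZZ (w : 'cV[R]_m0) d : dot (rsubmx X *m w + d *: V)
      (rsubmx X *m ((- (2 * t * C)) *: gamma)) = - (2 * t * C) * dot w gamma.
    by have := dec w ((- (2 * t * C)) *: gamma) d 0;
       rewrite scale0r addr0 => ->; rewrite dotZr; ring.
  rewrite Xe; case: (split_ordP i) => k ->.
    have -> : (- lambda *: z) (lshift m0 k) 0 = - lambda.
      by rewrite mxE /z col_mxEu mxE mulr1.
    have [|] : col (lshift m0 k) X = col (idx1 m0) X \/
               col (lshift m0 k) X = col (idx2 m0) X.
      by case: k => [[|[|k]] hk] //; [left|right]; congr (col _ X); apply/val_inj.
    - by move->; rewrite eX1 ZZ dotZl -tphi -Cg; ring.
    - by move->; rewrite eX2 ZZ dotZl -tphi -Cg; ring.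
  have -> : col (rshift 2 k) X = rsubmx X *m delta_mx k 0 + 0 *: V.
    by rewrite scale0r addr0 -colE; apply/matrixP => a b; rewrite !mxE.
  have -> : dot (rsubmx X *m delta_mx k 0 + 0 *: V)
      (rsubmx X *m ((- (2 * t * C)) *: gamma)) = - (2 * t * C) * gamma k 0.
    rewrite ZZ; congr (_ * _); rewrite dotE (bigD1 k) //= big1 => [|a ak].
      by rewrite mxE !eqxx mul1r addr0.
    by rewrite mxE (negbTE ak) mul0r.
  rewrite mxE /z col_mxEd mxE -tphi; field; exact: lt0r_neq0.
have z1 j : `|z j 0| <= 1.
  case: (split_ordP j) => k ->; rewrite /z ?col_mxEu ?col_mxEd mxE ?normr1 //.
  (* The sup norm condition also forces [C >= 0], since [gamma] is nonzero; multiplying it by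
     [2 * C] then bounds each entry of [2 * C *: gamma] by [phi2]. *)
  have g0 : 0 <= C * l2norm gamma ^+ 2 by apply: le_trans hgammaoo.
  have g1 : 0 < l2norm gamma ^+ 2.
    rewrite lt_neqAle sqr_ge0 andbT; apply/eqP => g2.
    by move: phi2_gt0; rewrite phi2E -g2 mulr0 ltxx.
  have C0 : 0 <= C by rewrite -(pmulr_lge0 _ g1).
  rewrite normrM ger0_norm ?divr_ge0 ?mulr_ge0 // ?(ltW phi2_gt0) //.
  rewrite mulrAC ler_pdivrMr // mul1r phi2E.
  have := le_trans (entry_le_norm gamma k) hgammaoo; nra.
have b0E k : beta0 (rshift 2 k) 0 = 0.
  have : rshift 2 k \notin active_set beta0 by rewrite hbeta0 !inE.
  by rewrite inE negbK => /eqP.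
have zb j : z j 0 * (beta0 - e) j 0 = `|(beta0 - e) j 0|.
  case: (split_ordP j) => k ->; last first.
    have -> : (beta0 - e) (rshift 2 k) 0 = 0.
      by rewrite mxE b0E mxE /e col_mxEd mxE subrr.
    by rewrite normr0 mulr0.
  (* The lower bound on the active coefficients keeps them nonnegative after the shift by [t], as
     the sign 1 in [z] demands. *)
  rewrite /z col_mxEu mxE mul1r ger0_norm // mxE mxE /e col_mxEu mxE subr_ge0.
  have [->|->] : lshift m0 k = idx1 m0 \/ lshift m0 k = idx2 m0.
    by case: k => [[|[|k]] hk] //; [left|right]; apply/val_inj.
  - exact: le_trans lb2 b21.
  - exact: lb2.
have Xb := noiseless_lasso_prediction_unique l0 kkt z1 zb hbetas.
(* The squared residual is 4 t^2 C^2 |gamma|_2^2 = 2 t^2 [phi2] = 2 t [lambda]. *)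
rewrite mulmxBr Xb -mulmxBr Xe l2norm_sqr.
have := dec ((- (2 * t * C)) *: gamma) ((- (2 * t * C)) *: gamma) 0 0.
rewrite scale0r addr0 => ->; rewrite !(dotZl, dotZr) mul0r mul0r addr0.
have -> : 2 * lambda ^+ 2 / phi2 = 2 * t * lambda by rewrite /t; ring.
rewrite -tphi -{1}Cg; ring.
Qed.
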